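(* Let $Q$ be a restriction quantal frame. The map $\chi\colon Q\to\Omega(\mathsf{C}(Q))$, $\chi(a)=\mathscr{X}_a=\{A\in\mathsf{C}(Q):a\in A\}$, is a morphism of restriction quantal frames; in particular $\mathscr{X}_{ab}=\mathscr{X}_a\mathscr{X}_b$, $(\mathscr{X}_a)^{\ast}=\mathscr{X}_{a^{\ast}}$, $(\mathscr{X}_a)^{+}=\mathscr{X}_{a^{+}}$, and $\mathscr{X}_a$ is a partial isometry of $\Omega(\mathsf{C}(Q))$ whenever $a$ is a partial isometry of $Q$.
   Context: A restriction quantal frame is a frame $(Q,\le)$ with associative multiplication distributing over arbitrary joins on both sides, which is a monoid with identity $e$ and carries join-preserving unary operations $a\mapsto a^{\ast}$, $a\mapsto a^{+}$ with values in the set $e^{\downarrow}=\{x:x\le e\}$ of projections (a commutative subsemigroup of idempotents), fixing projections, with $aa^{\ast}=a$, $a^{+}a=a$, $(ab)^{\ast}=(a^{\ast}b)^{\ast}$, $(ab)^{+}=(ab^{+})^{+}$; the top element is a join of partial isometries ($a$ with $b\le a\Rightarrow b=b^{+}a=ab^{\ast}$) and partial isometries are closed under product. A morphism of restriction quantal frames is a semigroup homomorphism preserving all joins, finite meets, $\ast$, $+$, top element and identity, and mapping partial isometries to partial isometries. $\mathsf{C}(Q)$ is the étale topological category of completely prime filters of $Q$ (nonempty, upward closed, closed under binary meets, $0\notin A$, and $\bigvee_i a_i\in A\Rightarrow$ some $a_i\in A$), with $\mathbf{d}(A)=\{x:\exists a\in A,\ a^{\ast}\le x\}$, $\mathbf{r}(A)=\{x:\exists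 a\in A,\ a^{+}\le x\}$, $A\cdot B=\{x:\exists a\in A,b\in B,\ ab\le x\}$ defined iff $\mathbf{d}(A)=\mathbf{r}(B)$, and topology with base $\{\mathscr{X}_a:a \text{ a partial isometry}\}$. For an étale topological category $C$, $\Omega(C)$ denotes the restriction quantal frame of open subsets of $C$ under inclusion, with $UV=\{uv:u\in U,v\in V,\mathbf{d}(u)=\mathbf{r}(v)\}$, identity the set of identities, $U^{\ast}=\mathbf{d}(U)$, $U^{+}=\mathbf{r}(U)$. *)

(* Defs.v *)
Set Implicit Arguments.

Definition image {X Y : Type} (f : X -> Y) (S : X -> Prop) : Y -> Prop :=
  fun y => exists x, S x /\ y = f x.

Record RQF := {
  car :> Type;
  le : car -> car -> Prop;
  sup : (car -> Prop) -> car;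
  mul : car -> car -> car;
  e : car;
  star : car -> car;
  plus : car -> car;

  le_refl : forall a, le a a;
  le_trans : forall a b c, le a b -> le b c -> le a c;
  le_antisym : forall a b, le a b -> le b a -> a = b;
  sup_ub : forall S a, S a -> le a (sup S);
  sup_least : forall S b, (forall a, S a -> le a b) -> le (sup S) b;
  (* frame law: binary meets distribute over arbitrary joins *)
  frame_distr : forall a S,
    sup (fun x => le x a /\ le x (sup S)) =
    sup (image (fun s => sup (fun x => le x a /\ le x s)) S);

  mul_assoc : forall a b c, mul a (mul b c) = mul (mul a b) c;
  mul_e_l : forall a, mul e a = a;
  mul_e_r : forall a, mul a e = a;
  mul_sup_l : forall a S, mul a (sup S) = sup (image (mul a) S);
  mul_sup_r : forall a S, mul (sup S) a = sup (image (fun s => mul s a) S);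

  star_sup : forall S, star (sup S) = sup (image star S);
  plus_sup : forall S, plus (sup S) = sup (image plus S);
  star_le_e : forall a, le (star a) e;
  plus_le_e : forall a, le (plus a) e;
  proj_mul_closed : forall x y, le x e -> le y e -> le (mul x y) e;
  proj_comm : forall x y, le x e -> le y e -> mul x y = mul y x;
  proj_idem : forall x, le x e -> mul x x = x;
  star_proj : forall x, le x e -> star x = x;
  plus_proj : forall x, le x e -> plus x = x;
  mul_star : forall a, mul a (star a) = a;
  plus_mul : forall a, mul (plus a) a = a;
  star_mul : forall a b, star (mul a b) = star (mul (star a) b);
  plus_mul2 : forall a b, plus (mul a b) = plus (mul a (plus b));

  (* the top is a join of partial isometries; partial isometries are
     closed under product *)
  top_pi : sup (fun _ => True) =
           sup (fun a => forall b, le b a -> b = mul (plus b) a /\ b = mul a (star b));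
  pi_mul : forall a b,
    (forall c, le c a -> c = mul (plus c) a /\ c = mul a (star c)) ->
    (forall c, le c b -> c = mul (plus c) b /\ c = mul b (star c)) ->
    (forall c, le c (mul a b) -> c = mul (plus c) (mul a b) /\ c = mul (mul a b) (star c))
}.

Arguments le {r}. Arguments sup {r}. Arguments mul {r}. Arguments e {r}.
Arguments star {r}. Arguments plus {r}.

Section Defs.
Variable Q : RQF.

Definition top : Q := sup (fun _ => True).
Definition bot : Q := sup (fun _ => False).
Definition meet (a b : Q) : Q := sup (fun x => le x a /\ le x b).

Definition pisom (a : Q) : Prop :=
  forall b, le b a -> b = mul (plus b) a /\ b = mul a (star b).

Definition cpfilter (A : Q -> Prop) : Prop :=
  (exists a, A a) /\
  (forall a b, A a -> le a b -> A b) /\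
  (forall a b, A a -> A b -> A (meet a b)) /\
  ~ A bot /\
  (forall S, A (sup S) -> exists a, S a /\ A a).

(* an arrow of C(Q) is (represented by) a completely prime filter *)
Definition dom (A : Q -> Prop) : Q -> Prop :=
  fun x => exists a, A a /\ le (star a) x.
Definition ran (A : Q -> Prop) : Q -> Prop :=
  fun x => exists a, A a /\ le (plus a) x.
Definition comp (A B : Q -> Prop) : Q -> Prop :=
  fun x => exists a b, A a /\ B b /\ le (mul a b) x.

Definition chi (a : Q) : (Q -> Prop) -> Prop :=
  fun A => cpfilter A /\ A a.

Definition CSet := (Q -> Prop) -> Prop.

Definition subset (U V : CSet) : Prop := forall A, U A -> V A.

Definition is_open (U : CSet) : Prop :=
  subset U cpfilter /\
  forall A, U A -> exists a, pisom a /\ chi a A /\ subset (chi a) U.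

Definition Otop : CSet := cpfilter.

Definition Omul (U V : CSet) : CSet :=
  fun C => exists A B, U A /\ V B /\ dom A = ran B /\ C = comp A B.

Definition Oe : CSet :=
  fun C => exists A, cpfilter A /\ C = dom A.

Definition Ostar (U : CSet) : CSet := image dom U.
Definition Oplus (U : CSet) : CSet := image ran U.

Definition Opisom (U : CSet) : Prop :=
  forall V, is_open V -> subset V U ->
    V = Omul (Oplus V) U /\ V = Omul U (Ostar V).

Definition chi_is_RQF_morphism : Prop :=
  (forall a, is_open (chi a)) /\
  (forall a b, chi (mul a b) = Omul (chi a) (chi b)) /\
  (forall S : Q -> Prop,
     chi (sup S) = fun A => exists s, S s /\ chi s A) /\
  (forall a b, chi (meet a b) = fun A => chi a A /\ chi b A) /\
  chi top = Otop /\
  (forall a, chi (star a) = Ostar (chi a)) /\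
  (forall a, chi (plus a) = Oplus (chi a)) /\
  chi (@e Q) = Oe /\
  (forall a, pisom a -> Opisom (chi a)).

End Defs.

(* Main.v *)
Require Import Defs.
From Stdlib Require Import FunctionalExtensionality PropExtensionality.
Set Implicit Arguments.
Unset Strict Implicit.

(* Composable filters compose
   to a filter with dom (A B) = dom B, and two filters sharing a partial
   isometry and a domain coincide.  Hence X_{ab} = X_a X_b: a filter C
   containing ab contains a product p = a1 b1 of partial isometries, and a germ
   of a1 composed with a germ of b1 is a filter containing p with the domain of
   C, so it is C. *)

Lemma pred_ext {X : Type} (P R : X -> Prop) : (forall x, P x <-> R x) -> P = R.
Proof.
  intros H. apply functional_extensionality; intro x.
  apply propositional_extensionality; auto.
Qed.

Lemma image_comp {X Y Z : Type} (f : X -> Y) (g : Y -> Z) (S : X -> Prop) :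
  image g (image f S) = image (fun s => g (f s)) S.
Proof.
  apply pred_ext; intro z; split.
  - intros [y [[x [Hx ->]] ->]]. exists x. auto.
  - intros [x [Hx ->]]. exists (f x). split; [exists x; auto | reflexivity].
Qed.

Section Algebra.
Variable Q : RQF.
Implicit Types a b c g p x y : Q.
Implicit Types S : Q -> Prop.

Lemma sup_pair x y : le x y -> sup (fun z => z = x \/ z = y) = y.
Proof.
  intro H. apply le_antisym.
  - apply sup_least. intros z [-> | ->]; auto using le_refl.
  - apply sup_ub. auto.
Qed.

Lemma join_preserving_mono (f : Q -> Q) :
  (forall S, f (sup S) = sup (image f S)) -> forall x y, le x y -> le (f x) (f y).
Proof.
  intros Hf x y Hxy. rewrite <- (sup_pair Hxy), Hf. apply sup_ub. exists x. auto.
Qed.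

Lemma mul_mono_r a x y : le x y -> le (mul a x) (mul a y).
Proof. apply join_preserving_mono. intro S. apply mul_sup_l. Qed.

Lemma mul_mono_l a x y : le x y -> le (mul x a) (mul y a).
Proof. apply (join_preserving_mono (f := fun z => mul z a)). intro S. apply mul_sup_r. Qed.

Lemma mul_mono a b x y : le a b -> le x y -> le (mul a x) (mul b y).
Proof. intros. eapply le_trans; [apply mul_mono_l | apply mul_mono_r]; eauto. Qed.

Lemma star_mono x y : le x y -> le (star x) (star y).
Proof. apply join_preserving_mono, star_sup. Qed.

Lemma plus_mono x y : le x y -> le (plus x) (plus y).
Proof. apply join_preserving_mono, plus_sup. Qed.

Lemma meet_lb1 a b : le (meet Q a b) a.
Proof. apply sup_least. intros z [H _]; exact H. Qed.

Lemma meet_lb2 a b : le (meet Q a b) b.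
Proof. apply sup_least. intros z [_ H]; exact H. Qed.

Lemma meet_glb a b c : le c a -> le c b -> le c (meet Q a b).
Proof. intros; apply sup_ub; auto. Qed.

Lemma le_top x : le x (top Q).
Proof. apply sup_ub. exact I. Qed.

Lemma meet_sup a S : meet Q a (sup S) = sup (image (meet Q a) S).
Proof. exact (frame_distr Q a S). Qed.

Lemma star_meet_sup a S :
  star (meet Q a (sup S)) = sup (image (fun s => star (meet Q a s)) S).
Proof. rewrite meet_sup, star_sup, image_comp. reflexivity. Qed.

(* An element vanishes exactly when its domain does (since x = x x^* ). *)
Lemma star_le_bot x : le (star x) (bot Q) <-> le x (bot Q).
Proof.
  split; intro H.
  - rewrite <- (mul_star _ x). eapply le_trans; [apply mul_mono_r; exact H|].
    unfold bot. rewrite mul_sup_l. apply sup_least. intros z [y [[] _]].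
  - eapply le_trans; [apply star_mono; exact H|].
    unfold bot at 1. rewrite star_sup. apply sup_least. intros z [y [[] _]].
Qed.

Lemma proj_mul_le p x : le p e -> le (mul p x) x.
Proof. intro H. rewrite <- (mul_e_l _ x) at 2. apply mul_mono_l; auto. Qed.

Lemma mul_proj_le p x : le p e -> le (mul x p) x.
Proof. intro H. rewrite <- (mul_e_r _ x) at 2. apply mul_mono_r; auto. Qed.

Lemma proj_absorb p c : le p c -> le c e -> mul c p = p /\ mul p c = p.
Proof.
  intros Hpc Hce. assert (Hpe : le p e) by (eapply le_trans; eauto).
  assert (E : mul p c = p).
  { apply le_antisym; [apply mul_proj_le; auto|].
    rewrite <- (proj_idem _ p) at 1 by auto. apply mul_mono_r; auto. }
  split; auto. rewrite proj_comm; auto.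
Qed.

Lemma star_mul_le a b : le (star (mul a b)) (star b).
Proof. rewrite star_mul. apply star_mono, proj_mul_le, star_le_e. Qed.

Lemma plus_mul_le a b : le (plus (mul a b)) (plus a).
Proof. rewrite plus_mul2. apply plus_mono, mul_proj_le, plus_le_e. Qed.

Lemma star_mul_matched a b : le (plus b) (star a) -> star (mul a b) = star b.
Proof.
  intro H. rewrite star_mul. f_equal.
  rewrite <- (plus_mul _ b) at 1. rewrite mul_assoc.
  rewrite (proj1 (proj_absorb H (star_le_e _ a))). apply plus_mul.
Qed.

Lemma pisom_down g x : pisom Q g -> le x g -> pisom Q x.
Proof.
  intros Hg Hx c Hc.
  assert (Hcg : le c g) by (eapply le_trans; eauto).
  destruct (Hg c Hcg) as [E1 E2]. destruct (Hg x Hx) as [F1 F2]. split.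
  - rewrite F1, mul_assoc, (proj2 (proj_absorb (plus_mono Hc) (plus_le_e _ x))).
    exact E1.
  - rewrite F2, <- mul_assoc, (proj1 (proj_absorb (star_mono Hc) (star_le_e _ x))).
    exact E2.
Qed.

Lemma pisom_le_of_star g x y :
  pisom Q g -> le x g -> le y g -> le (star x) (star y) -> le x y.
Proof.
  intros Hg Hx Hy Hs.
  rewrite (proj2 (Hg x Hx)), (proj2 (Hg y Hy)). apply mul_mono_r; exact Hs.
Qed.

Lemma sup_pi a : a = sup (fun y => pisom Q y /\ le y a).
Proof.
  apply le_antisym.
  - apply le_trans with (meet Q a (top Q)); [apply meet_glb; auto using le_refl, le_top|].
    unfold top. rewrite (top_pi Q), meet_sup.
    apply sup_least. intros z [s [Hs ->]]. apply sup_ub. split.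
    + apply (pisom_down Hs), meet_lb2.
    + apply meet_lb1.
  - apply sup_least. intros z [_ H]; exact H.
Qed.

End Algebra.

Section Filters.
Variable Q : RQF.
Implicit Types a b c g p x y : Q.
Implicit Types A B C F : Q -> Prop.

Lemma cp_up A a b : cpfilter Q A -> A a -> le a b -> A b.
Proof. intros [_ [H _]]; eauto. Qed.

Lemma cp_meet A a b : cpfilter Q A -> A a -> A b -> A (meet Q a b).
Proof. intros [_ [_ [H _]]]; eauto. Qed.

Lemma cp_prime A S : cpfilter Q A -> A (sup S) -> exists a, S a /\ A a.
Proof. intros [_ [_ [_ [_ H]]]]; eauto. Qed.

Lemma cp_nle_bot A a : cpfilter Q A -> A a -> ~ le a (bot Q).
Proof. intros HA Ha Hb. destruct HA as [_ [Hup [_ [Hbot _]]]]. eauto. Qed.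

Lemma cp_pi A a : cpfilter Q A -> A a -> exists p, pisom Q p /\ le p a /\ A p.
Proof.
  intros HA Ha. rewrite (sup_pi a) in Ha.
  destruct (cp_prime HA Ha) as [p [[H1 H2] H3]]. eauto.
Qed.

Lemma cp_mul_pi C a b : cpfilter Q C -> C (mul a b) ->
  exists a1 b1, pisom Q a1 /\ le a1 a /\ pisom Q b1 /\ le b1 b /\ C (mul a1 b1).
Proof.
  intros HC Hab.
  rewrite (sup_pi a), mul_sup_r in Hab.
  destruct (cp_prime HC Hab) as [y [[a1 [[Ha1 Ha1a] ->]] H1]].
  rewrite (sup_pi b), mul_sup_l in H1.
  destruct (cp_prime HC H1) as [y [[b1 [[Hb1 Hb1b] ->]] H2]].
  exists a1, b1. auto.
Qed.

Lemma dom_has_e A : cpfilter Q A -> dom Q A e.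
Proof. intros [[a Ha] _]. exists a. split; auto. apply star_le_e. Qed.

Lemma dom_cp A : cpfilter Q A -> cpfilter Q (dom Q A).
Proof.
  intros HA. split; [|split; [|split; [|split]]].
  - exists e. apply dom_has_e; auto.
  - intros x y [a [Ha H]] Hxy. exists a. split; auto. eapply le_trans; eauto.
  - intros x y [a1 [Ha1 H1]] [a2 [Ha2 H2]]. exists (meet Q a1 a2).
    split; [apply cp_meet; auto|]. apply meet_glb.
    + eapply le_trans; [apply star_mono, meet_lb1 | exact H1].
    + eapply le_trans; [apply star_mono, meet_lb2 | exact H2].
  - intros [a [Ha H]]. apply (cp_nle_bot HA Ha), star_le_bot. exact H.
  - intros S [a [Ha H]].
    (* a = a a^* lies below the join of the a (e /\ s), s in S *)
    assert (Hsup : A (sup (image (fun s => mul a (meet Q e s)) S))).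
    { rewrite <- image_comp, <- mul_sup_l, <- meet_sup.
      apply (cp_up HA Ha). rewrite <- (mul_star _ a) at 1.
      apply mul_mono_r, meet_glb; auto using star_le_e. }
    destruct (cp_prime HA Hsup) as [y [[s [Hs ->]] Hy]].
    exists s. split; auto. exists (mul a (meet Q e s)). split; auto.
    eapply le_trans; [apply star_mul_le|].
    rewrite star_proj by apply meet_lb1. apply meet_lb2.
Qed.

Lemma dom_e C : cpfilter Q C -> C e -> dom Q C = C.
Proof.
  intros HC He. apply pred_ext. intro x. split.
  - intros [a [Ha H]]. apply (cp_up HC (cp_meet HC Ha He)).
    eapply le_trans; [|exact H].
    rewrite <- (star_proj _ _ (meet_lb2 a e)). apply star_mono, meet_lb1.
  - intros Hx. exists (meet Q x e). split; [apply cp_meet; auto|].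
    rewrite (star_proj _ _ (meet_lb2 x e)). apply meet_lb1.
Qed.

Definition germ F g : Q -> Prop :=
  fun x => exists c, F c /\ le c e /\ le (mul g c) x.

Lemma star_germ F g c :
  cpfilter Q F -> F (star g) -> F c -> le c e -> F (star (mul g c)).
Proof.
  intros HF Hg Hc Hce.
  rewrite star_mul, star_proj by (apply proj_mul_closed; auto using star_le_e).
  apply (cp_up HF (cp_meet HF Hg Hc)).
  rewrite <- (proj_idem _ (meet Q (star g) c)) by (eapply le_trans; [apply meet_lb2 | exact Hce]).
  apply mul_mono; [apply meet_lb1 | apply meet_lb2].
Qed.

Lemma germ_g F g : cpfilter Q F -> F (star g) -> germ F g g.
Proof.
  intros. exists (star g). split; auto. split; [apply star_le_e|].
  rewrite mul_star. apply le_refl.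
Qed.

Lemma germ_cp F g : cpfilter Q F -> pisom Q g -> F (star g) -> cpfilter Q (germ F g).
Proof.
  intros HF Hg Hs. split; [|split; [|split; [|split]]].
  - exists g. apply germ_g; auto.
  - intros x y [c [H1 [H2 H3]]] Hxy. exists c. split; auto. split; auto.
    eapply le_trans; eauto.
  - intros x y [c1 [H1 [H2 H3]]] [c2 [K1 [K2 K3]]]. exists (meet Q c1 c2).
    split; [apply cp_meet; auto|]. split; [eapply le_trans; [apply meet_lb1 | auto]|].
    apply meet_glb.
    + eapply le_trans; [apply mul_mono_r, meet_lb1 | auto].
    + eapply le_trans; [apply mul_mono_r, meet_lb2 | auto].
  - intros [c [H1 [H2 H3]]]. apply (cp_nle_bot HF (star_germ HF Hs H1 H2)).
    apply star_le_bot. exact H3.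
  - intros S [c [Hc [Hce Hle]]].
    set (h := mul g c) in *.
    assert (Hhg : le h g) by (apply mul_proj_le; auto).
    assert (Hsup : F (star (meet Q h (sup S)))).
    { apply (cp_up HF (star_germ HF Hs Hc Hce)).
      apply star_mono, meet_glb; auto using le_refl. }
    rewrite star_meet_sup in Hsup.
    destruct (cp_prime HF Hsup) as [y [[s [Hs0 ->]] Hy]].
    exists s. split; auto.
    exists (star (meet Q h s)). split; auto. split; [apply star_le_e|].
    apply le_trans with (meet Q h s); [|apply meet_lb2].
    apply (pisom_le_of_star Hg).
    + apply mul_proj_le, star_le_e.
    + eapply le_trans; [apply meet_lb1 | exact Hhg].
    + eapply le_trans; [apply star_mul_le|]. rewrite star_proj by apply star_le_e.
      apply le_refl.
Qed.

Lemma germ_dom F g : cpfilter Q F -> F (star g) -> dom Q (germ F g) = F.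
Proof.
  intros HF Hs. apply pred_ext. intro x. split.
  - intros [y [[c [H1 [H2 H3]]] H4]]. apply (cp_up HF (star_germ HF Hs H1 H2)).
    eapply le_trans; [apply star_mono; exact H3 | exact H4].
  - intros Hx. assert (He : F e) by (apply (cp_up HF Hs), star_le_e).
    exists (mul g (meet Q x e)). split.
    + exists (meet Q x e). split; [apply cp_meet; auto|]. split; [apply meet_lb2 | apply le_refl].
    + eapply le_trans; [apply star_mul_le|].
      rewrite star_proj by apply meet_lb2. apply meet_lb1.
Qed.

(* If F contains the domain of a g, the range of the germ of g at F contains a^*:
   indeed a^* g = g (a g)^* lies in the germ and has range below a^*. *)
Lemma germ_ran_star F g a :
  cpfilter Q F -> pisom Q g -> F (star (mul a g)) -> ran Q (germ F g) (star a).
Proof.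
  intros HF Hg Had.
  exists (mul (star a) g). split.
  - exists (star (mul a g)). split; auto. split; [apply star_le_e|].
    rewrite (proj2 (Hg _ (proj_mul_le _ (star_le_e _ a)))), <- star_mul.
    apply le_refl.
  - rewrite <- (plus_proj _ (star a)) at 2 by apply star_le_e. apply plus_mul_le.
Qed.

(* X_{a^*} = (X_a)^*: every filter containing a^* is the domain of a germ. *)
Lemma chi_star a : chi Q (star a) = Ostar (chi Q a).
Proof.
  apply pred_ext. intro C. split.
  - intros [HC Hs]. rewrite (sup_pi a), star_sup in Hs.
    destruct (cp_prime HC Hs) as [y [[g [[Hg Hga] ->]] Hy]].
    exists (germ C g). split.
    + split; [apply germ_cp; auto|].
      apply (cp_up (germ_cp HC Hg Hy) (germ_g HC Hy) Hga).
    + symmetry. apply germ_dom; auto.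
  - intros [A [[HA Ha] ->]]. split; [apply dom_cp; auto|].
    exists a. split; auto using le_refl.
Qed.

Lemma comp_ran B : cpfilter Q B -> comp Q (ran Q B) B = B.
Proof.
  intros HB. apply pred_ext. intro x. split.
  - intros [r [b [[b2 [Hb2 H1]] [Hb H2]]]].
    apply (cp_up HB (cp_meet HB Hb Hb2)). eapply le_trans; [|exact H2].
    rewrite <- (plus_mul _ (meet Q b b2)) at 1. apply mul_mono.
    + eapply le_trans; [apply plus_mono, meet_lb2 | exact H1].
    + apply meet_lb1.
  - intro Hx. exists (plus x), x. split; [exists x; split; auto using le_refl|].
    split; auto. rewrite plus_mul. apply le_refl.
Qed.

Lemma ran_inj_sub a A B : pisom Q a -> cpfilter Q A -> cpfilter Q B -> A a -> B a ->
  ran Q A = ran Q B -> forall x, A x -> B x.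
Proof.
  intros Ha HA HB HAa HBa E x Hx.
  set (y := meet Q x a).
  assert (Hr : ran Q B (plus y)).
  { rewrite <- E. exists y. split; [apply cp_meet; auto | apply le_refl]. }
  destruct Hr as [b [Hb H1]].
  apply (cp_up HB (cp_meet HB Hb HBa)).
  apply le_trans with y; [|apply meet_lb1].
  rewrite (proj1 (Ha _ (meet_lb2 b a))), (proj1 (Ha y (meet_lb2 _ _))).
  apply mul_mono_l. eapply le_trans; [apply plus_mono, meet_lb1 | exact H1].
Qed.

Lemma ran_inj a A B : pisom Q a -> cpfilter Q A -> cpfilter Q B -> A a -> B a ->
  ran Q A = ran Q B -> A = B.
Proof.
  intros. apply pred_ext; split; eapply ran_inj_sub; eauto.
Qed.

End Filters.

(* The opposite restriction quantal frame: reversed multiplication, with * and +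
   exchanged.  It turns statements about domains into statements about ranges. *)
Lemma pisom_swap (Q : RQF) (a : Q) :
  pisom Q a <-> (forall b, le b a -> b = mul a (star b) /\ b = mul (plus b) a).
Proof. unfold pisom. split; intros H b Hb; destruct (H b Hb); auto. Qed.

Definition op (Q : RQF) : RQF.
Proof.
  refine (@Build_RQF (car Q) (@le Q) (@sup Q) (fun a b => mul b a) e plus star
    (le_refl Q) (le_trans Q) (le_antisym Q) (sup_ub Q) (sup_least Q) (frame_distr Q)
    _ (mul_e_r Q) (mul_e_l Q) _ _ (plus_sup Q) (star_sup Q) (plus_le_e Q) (star_le_e Q)
    _ _ (proj_idem Q) (plus_proj Q) (star_proj Q) (plus_mul Q) (mul_star Q) _ _ _ _).
  - intros a b c. symmetry. apply mul_assoc.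
  - intros a S. apply mul_sup_r.
  - intros a S. apply mul_sup_l.
  - intros x y Hx Hy. apply proj_mul_closed; auto.
  - intros x y Hx Hy. apply proj_comm; auto.
  - intros a b. apply plus_mul2.
  - intros a b. apply star_mul.
  - rewrite top_pi. f_equal. apply pred_ext. intro a. apply pisom_swap.
  - intros a b Ha Hb c Hc.
    destruct (pi_mul Q b a (proj2 (pisom_swap b) Hb) (proj2 (pisom_swap a) Ha) c Hc).
    simpl. split; auto.
Defined.

Lemma pisom_op (Q : RQF) (a : Q) : pisom Q a -> pisom (op Q) a.
Proof. intros H b Hb. destruct (H b Hb). split; auto. Qed.

Lemma comp_op (Q : RQF) (A B : Q -> Prop) : comp (op Q) A B = comp Q B A.
Proof.
  apply pred_ext. intro x. split; intros [a [b [H1 [H2 H3]]]]; exists b, a; auto.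
Qed.

Section Duality.
Variable Q : RQF.
Implicit Types A B C : Q -> Prop.

Lemma ran_cp A : cpfilter Q A -> cpfilter Q (ran Q A).
Proof. exact (@dom_cp (op Q) A). Qed.

Lemma ran_has_e A : cpfilter Q A -> ran Q A e.
Proof. exact (@dom_has_e (op Q) A). Qed.

Lemma ran_e C : cpfilter Q C -> C e -> ran Q C = C.
Proof. exact (@dom_e (op Q) C). Qed.

Lemma comp_dom B : cpfilter Q B -> comp Q B (dom Q B) = B.
Proof. intro HB. rewrite <- comp_op. exact (@comp_ran (op Q) B HB). Qed.

Lemma dom_inj (a : Q) A B : pisom Q a -> cpfilter Q A -> cpfilter Q B -> A a -> B a ->
  dom Q A = dom Q B -> A = B.
Proof. intros Ha. exact (@ran_inj (op Q) a A B (pisom_op Ha)). Qed.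

Lemma dom_ran A : cpfilter Q A -> dom Q (ran Q A) = ran Q A.
Proof. intro HA. apply dom_e; [apply ran_cp | apply ran_has_e]; auto. Qed.

Lemma ran_dom A : cpfilter Q A -> ran Q (dom Q A) = dom Q A.
Proof. intro HA. apply ran_e; [apply dom_cp | apply dom_has_e]; auto. Qed.

End Duality.

Section Composition.
Variable Q : RQF.
Implicit Types a b : Q.
Implicit Types A B C : Q -> Prop.

Lemma composable_refine A B a b : cpfilter Q B -> dom Q A = ran Q B -> A a -> B b ->
  exists b', B b' /\ le b' b /\ le (plus b') (star a).
Proof.
  intros HB E Ha Hb.
  assert (H : ran Q B (star a)) by (rewrite <- E; exists a; split; auto using le_refl).
  destruct H as [b'' [Hb'' Hle]].
  exists (meet Q b b''). split; [apply cp_meet; auto|]. split; [apply meet_lb1|].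
  eapply le_trans; [apply plus_mono, meet_lb2 | exact Hle].
Qed.

Lemma dom_comp A B : cpfilter Q A -> cpfilter Q B -> dom Q A = ran Q B ->
  dom Q (comp Q A B) = dom Q B.
Proof.
  intros HA HB E. apply pred_ext. intro x. split.
  - intros [y [[a [b [Ha [Hb Hle]]]] Hy]].
    destruct (composable_refine HB E Ha Hb) as [b' [Hb' [Hb'b Hm]]].
    exists b'. split; auto. rewrite <- (star_mul_matched Hm).
    eapply le_trans; [|exact Hy]. apply star_mono.
    eapply le_trans; [apply mul_mono_r; exact Hb'b | exact Hle].
  - intros [b [Hb Hx]]. destruct HA as [[a Ha] _].
    destruct (composable_refine HB E Ha Hb) as [b' [Hb' [Hb'b Hm]]].
    exists (mul a b'). split; [exists a, b'; auto using le_refl|].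
    rewrite (star_mul_matched Hm). eapply le_trans; [apply star_mono; exact Hb'b | exact Hx].
Qed.

(* Complete primeness of a composite: a b <= sup S with a, b partial
   isometries; the domain of B contains (a b /\ sup S)^*, hence some
   (a b /\ s)^*, and a suitable restriction of a b then lies below s. *)
Lemma comp_prime A B S : cpfilter Q A -> cpfilter Q B -> dom Q A = ran Q B ->
  comp Q A B (sup S) -> exists s, S s /\ comp Q A B s.
Proof.
  intros HA HB E [a' [b' [Ha' [Hb' Hle]]]].
  destruct (cp_pi HA Ha') as [a [Ha [Haa' HAa]]].
  destruct (cp_pi HB Hb') as [b [Hb [Hbb' HBb]]].
  set (p := mul a b).
  assert (Hp : pisom Q p) by exact (pi_mul Q a b Ha Hb).
  assert (Hps : le p (sup S)) by (eapply le_trans; [apply mul_mono; eauto | exact Hle]).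
  destruct (composable_refine HB E HAa HBb) as [b1 [HBb1 [Hb1b Hm]]].
  assert (Hdom : dom Q B (star (meet Q p (sup S)))).
  { exists b1. split; auto. rewrite <- (star_mul_matched Hm).
    apply star_mono, meet_glb.
    - apply mul_mono_r; exact Hb1b.
    - eapply le_trans; [apply mul_mono_r; exact Hb1b | exact Hps]. }
  rewrite star_meet_sup in Hdom.
  destruct (cp_prime (dom_cp HB) Hdom) as [y [[s [Hs ->]] [b2 [HBb2 Hb2]]]].
  exists s. split; auto.
  exists a, (meet Q b1 b2). split; auto. split; [apply cp_meet; auto|].
  apply le_trans with (meet Q p s); [|apply meet_lb2].
  apply (pisom_le_of_star Hp).
  - apply mul_mono_r. eapply le_trans; [apply meet_lb1 | exact Hb1b].
  - apply meet_lb1.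
  - eapply le_trans; [apply star_mul_le|].
    eapply le_trans; [apply star_mono, meet_lb2 | exact Hb2].
Qed.

Lemma comp_cp A B : cpfilter Q A -> cpfilter Q B -> dom Q A = ran Q B ->
  cpfilter Q (comp Q A B).
Proof.
  intros HA HB E. split; [|split; [|split; [|split]]].
  - destruct HA as [[a Ha] _]. destruct HB as [[b Hb] _].
    exists (mul a b), a, b. auto using le_refl.
  - intros x y [a [b [Ha [Hb Hx]]]] Hxy. exists a, b. split; auto. split; auto.
    eapply le_trans; eauto.
  - intros x y [a1 [b1 [Ha1 [Hb1 Hx]]]] [a2 [b2 [Ha2 [Hb2 Hy]]]].
    exists (meet Q a1 a2), (meet Q b1 b2).
    split; [apply cp_meet; auto|]. split; [apply cp_meet; auto|].
    apply meet_glb.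
    + eapply le_trans; [|exact Hx]. apply mul_mono; apply meet_lb1.
    + eapply le_trans; [|exact Hy]. apply mul_mono; apply meet_lb2.
  - intros [a [b [Ha [Hb Hbot]]]].
    destruct (composable_refine HB E Ha Hb) as [b' [Hb' [Hb'b Hm]]].
    apply (cp_nle_bot HB Hb'), star_le_bot.
    rewrite <- (star_mul_matched Hm). apply star_le_bot.
    eapply le_trans; [apply mul_mono_r; exact Hb'b | exact Hbot].
  - intros S. apply comp_prime; auto.
Qed.

(* A filter C containing a product a b of partial isometries is the composite
   of a germ of a (at the range of B) with a germ B of b (at the domain of C):
   the composite contains a b and has the domain of C, so it equals C. *)
Lemma cp_factor C a b : cpfilter Q C -> pisom Q a -> pisom Q b -> C (mul a b) ->
  exists A B, chi Q a A /\ chi Q b B /\ dom Q A = ran Q B /\ C = comp Q A B.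
Proof.
  intros HC Ha Hb Hab.
  set (D := dom Q C).
  assert (HD : cpfilter Q D) by (apply dom_cp; auto).
  assert (HDab : D (star (mul a b))) by (exists (mul a b); split; auto using le_refl).
  assert (HDb : D (star b)) by (apply (cp_up HD HDab), star_mul_le).
  set (B := germ D b).
  assert (HB : cpfilter Q B) by (apply germ_cp; auto).
  assert (HFa : ran Q B (star a)) by (apply germ_ran_star; auto).
  set (A := germ (ran Q B) a).
  assert (HA : cpfilter Q A) by (apply germ_cp; auto using ran_cp).
  assert (E : dom Q A = ran Q B) by (apply germ_dom; auto using ran_cp).
  exists A, B. split; [split; auto; apply germ_g; auto using ran_cp|].
  split; [split; auto; apply germ_g; auto|]. split; auto.
  apply (dom_inj (pi_mul Q a b Ha Hb)); auto.
  - apply comp_cp; auto.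
  - exists a, b. split; [apply germ_g; auto using ran_cp|].
    split; [apply germ_g; auto | apply le_refl].
  - rewrite dom_comp by auto. symmetry. apply germ_dom; auto.
Qed.

End Composition.

Section Morphism.
Variable Q : RQF.
Implicit Types a b : Q.
Implicit Types A B C : Q -> Prop.
Implicit Types V : CSet Q.

(* X_a is open: it is covered by the X_p, p a partial isometry below a. *)
Lemma chi_open a : is_open (chi Q a).
Proof.
  split; [intros A H; apply H|].
  intros A [HA Ha]. destruct (cp_pi HA Ha) as [p [Hp [Hpa HAp]]].
  exists p. split; auto. split; [split; auto|].
  intros B [HB HBp]. split; auto. apply (cp_up HB HBp Hpa).
Qed.

Lemma chi_mul a b : chi Q (mul a b) = Omul (chi Q a) (chi Q b).
Proof.
  apply pred_ext. intro C. split.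
  - intros [HC Hab].
    destruct (cp_mul_pi HC Hab) as [a1 [b1 [Ha1 [Ha1a [Hb1 [Hb1b H1]]]]]].
    destruct (cp_factor HC Ha1 Hb1 H1) as [A [B [[HA HAa] [[HB HBb] [E ->]]]]].
    exists A, B. split; [split; auto; apply (cp_up HA HAa Ha1a)|].
    split; [split; auto; apply (cp_up HB HBb Hb1b)|]. auto.
  - intros [A [B [[HA Ha] [[HB Hb] [E ->]]]]]. split; [apply comp_cp; auto|].
    exists a, b. auto using le_refl.
Qed.

Lemma chi_sup S : chi Q (sup S) = fun A => exists s, S s /\ chi Q s A.
Proof.
  apply pred_ext. intro A. split.
  - intros [HA Hs]. destruct (cp_prime HA Hs) as [s [H1 H2]].
    exists s. split; auto. split; auto.
  - intros [s [Hs [HA Has]]]. split; auto. apply (cp_up HA Has). apply sup_ub; auto.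
Qed.

Lemma chi_meet a b : chi Q (meet Q a b) = fun A => chi Q a A /\ chi Q b A.
Proof.
  apply pred_ext. intro A. split.
  - intros [HA H]. split; split; auto; apply (cp_up HA H); [apply meet_lb1 | apply meet_lb2].
  - intros [[HA H1] [_ H2]]. split; auto. apply cp_meet; auto.
Qed.

Lemma chi_top : chi Q (top Q) = Otop Q.
Proof.
  apply pred_ext. intro A. split; [intros [HA _]; exact HA|].
  intros HA. split; auto. pose proof HA as [[a Ha] _].
  apply (cp_up HA Ha), le_top.
Qed.

Lemma chi_plus a : chi Q (plus a) = Oplus (chi Q a).
Proof. exact (chi_star (Q := op Q) a). Qed.

(* X_e is the set of identity arrows: filters containing e are their own domains. *)
Lemma chi_e : chi Q e = Oe Q.
Proof.
  apply pred_ext. intro C. split.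
  - intros [HC He]. exists C. split; auto. symmetry. apply dom_e; auto.
  - intros [A [HA ->]]. split; [apply dom_cp | apply dom_has_e]; auto.
Qed.

(* For a partial isometry a, any V inside X_a satisfies V = V^+ X_a: an arrow
   of X_a is determined by its range. *)
Lemma chi_pisom_left a V : pisom Q a -> subset V (chi Q a) ->
  V = Omul (Oplus V) (chi Q a).
Proof.
  intros Ha Hsub. apply pred_ext. intro C. split.
  - intros HVC. destruct (Hsub C HVC) as [HC HCa].
    exists (ran Q C), C. split; [exists C; split; auto|].
    split; [split; auto|]. split; [apply dom_ran; auto|].
    symmetry. apply comp_ran; auto.
  - intros [A [B [[A' [HVA' ->]] [[HB HBa] [E ->]]]]].
    destruct (Hsub A' HVA') as [HA' HA'a].
    rewrite dom_ran in E by auto.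
    rewrite <- (ran_inj Ha HA' HB HA'a HBa E), comp_ran; auto.
Qed.

(* Dually, V = X_a V^*: an arrow of X_a is determined by its domain. *)
Lemma chi_pisom_right a V : pisom Q a -> subset V (chi Q a) ->
  V = Omul (chi Q a) (Ostar V).
Proof.
  intros Ha Hsub. apply pred_ext. intro C. split.
  - intros HVC. destruct (Hsub C HVC) as [HC HCa].
    exists C, (dom Q C). split; [split; auto|].
    split; [exists C; split; auto|]. split; [symmetry; apply ran_dom; auto|].
    symmetry. apply comp_dom; auto.
  - intros [A [B [[HA HAa] [[A' [HVA' ->]] [E ->]]]]].
    destruct (Hsub A' HVA') as [HA' HA'a].
    rewrite ran_dom in E by auto.
    rewrite (dom_inj Ha HA HA' HAa HA'a E), comp_dom; auto.
Qed.

Lemma chi_pisom a : pisom Q a -> Opisom (chi Q a).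
Proof.
  intros Ha V _ Hsub. split; [apply chi_pisom_left | apply chi_pisom_right]; auto.
Qed.

End Morphism.

Theorem mainTheorem13 (Q : RQF) : chi_is_RQF_morphism Q.
Proof.
  unfold chi_is_RQF_morphism.
  split; [exact (@chi_open Q)|].
  split; [exact (@chi_mul Q)|].
  split; [exact (@chi_sup Q)|].
  split; [exact (@chi_meet Q)|].
  split; [exact (@chi_top Q)|].
  split; [exact (@chi_star Q)|].
  split; [exact (@chi_plus Q)|].
  split; [exact (@chi_e Q)|].
  exact (@chi_pisom Q).
Qed.
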